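(* Let $(T_i)_{i\in K}$ be a family of continuous positive linear maps $l_\infty\to l_\infty$ with adjoints $T_i^*$, and let $F=\bigcap_{i\in K}\{p\in\Delta: p\text{ is an eigenvector of }T_i^*\}$. If $\succsim$ satisfies Weak order, Monotonicity, Continuity, ICRP, Convexity, ISU and I$T_i$IS for every $i\in K$, then there exists a nonempty weak$^\star$-closed set $D\subseteq F$ such that $I(x)=\min_{p\in D}\langle x,p\rangle$ is the unique constant equivalent representing $\succsim$. Conversely, if $I(x)=\min_{p\in D}\langle x,p\rangle$ for some nonempty weak$^\star$-closed $D\subseteq F$, and $\langle1,T_i^*(p)\rangle\le1$ for every $p\in F$ and $i\in K$, then the relation represented by $I$ satisfies Weak order, Monotonicity, Continuity, ICRP, Convexity, ISU and I$T_i$IS for every $i\in K$.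
   Context: $l_\infty$: real bounded sequences indexed by $\mathbb N$; $\theta\in\mathbb R$ also a constant sequence; $x\ge y$ coordinatewise. $ba(\mathbb N)$: norm dual of $l_\infty$, pairing $\langle x,\mu\rangle$, weak$^\star$ topology. Adjoint: $\langle x,T_i^*(\mu)\rangle=\langle T_i(x),\mu\rangle$. $\Delta$: finitely additive probability measures on $2^{\mathbb N}$. Eigenvector: nonzero $\mu$ with $T_i^*\mu=\lambda\mu$ for some real $\lambda$. Constant equivalent: $I$ with $x\sim I(x)$, $x\succsim y\iff I(x)\ge I(y)$. Weak order: complete, transitive. Monotonicity: $x\ge y\Rightarrow x\succsim y$, $1\succ0$. Continuity: for $x\succsim y\succsim z$ the sets $\{\alpha\in[0,1]:\alpha x+(1-\alpha)z\succsim y\}$, $\{\alpha:y\succsim\alpha x+(1-\alpha)z\}$ are closed. ICRP: $x\succsim y\Rightarrow x+\theta\succsim y+\theta$. Convexity: $x\succsim\theta,y\succsim\theta\Rightarrow\lambda x+(1-\lambda)y\succsim\theta$. ISU: $x\succsim y$, $\alpha\ge0\Rightarrow\alpha x\succsim\alpha y$. I$T_i$IS: $x+d\succsim x\Rightarrow x+T_i(d)\succsim x$. *)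

(* Defs.v *)
From Stdlib Require Import Reals Lra List Rtopology.
Open Scope R_scope.

Record linf := mkL { lv :> nat -> R ; lbnd : exists M, forall n, Rabs (lv n) <= M }.

Lemma cst_bnd (t : R) : exists M, forall n : nat, Rabs ((fun _ : nat => t) n) <= M.
Proof. exists (Rabs t); intros; apply Rle_refl. Qed.
Definition lcst (t : R) : linf := mkL (fun _ => t) (cst_bnd t).

Lemma add_bnd (x y : linf) : exists M, forall n, Rabs (x n + y n) <= M.
Proof.
  destruct (lbnd x) as [a Ha]; destruct (lbnd y) as [b Hb]; exists (a + b); intro n.
  eapply Rle_trans; [apply Rabs_triang|]. specialize (Ha n); specialize (Hb n); lra.
Qed.
Definition ladd (x y : linf) : linf := mkL (fun n => x n + y n) (add_bnd x y).

Lemma scal_bnd (a : R) (x : linf) : exists M, forall n, Rabs (a * x n) <= M.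
Proof.
  destruct (lbnd x) as [b Hb]; exists (Rabs a * b); intro n.
  rewrite Rabs_mult; apply Rmult_le_compat_l; [apply Rabs_pos|apply Hb].
Qed.
Definition lscal (a : R) (x : linf) : linf := mkL (fun n => a * x n) (scal_bnd a x).

Definition lcomb (a : R) (x z : linf) : linf := ladd (lscal a x) (lscal (1 - a) z).

Lemma ind_bnd (A : nat -> bool) :
  exists M, forall n, Rabs ((fun n => if A n then 1 else 0) n) <= M.
Proof.
  exists 1; intro n; simpl; destruct (A n);
  [rewrite Rabs_R1 | rewrite Rabs_R0]; lra.
Qed.
Definition lind (A : nat -> bool) : linf := mkL (fun n => if A n then 1 else 0) (ind_bnd A).

Definition lge (x y : linf) : Prop := forall n, y n <= x n.

Definition is_linear_map (T : linf -> linf) : Prop :=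
  (forall x y n, T (ladd x y) n = T x n + T y n) /\
  (forall a x n, T (lscal a x) n = a * T x n).
Definition is_positive_map (T : linf -> linf) : Prop :=
  forall x, lge x (lcst 0) -> lge (T x) (lcst 0).
Definition is_continuous_map (T : linf -> linf) : Prop :=
  forall (x : linf) (eps : R), 0 < eps -> exists delta, 0 < delta /\
    forall y : linf, (forall n, Rabs (x n - y n) <= delta) ->
      forall n, Rabs (T x n - T y n) <= eps.

Definition is_ba (mu : linf -> R) : Prop :=
  (forall x y, mu (ladd x y) = mu x + mu y) /\
  (forall a x, mu (lscal a x) = a * mu x) /\
  (forall (x : linf) (eps : R), 0 < eps -> exists delta, 0 < delta /\
    forall y : linf, (forall n, Rabs (x n - y n) <= delta) -> Rabs (mu x - mu y) <= eps).

Definition adj (T : linf -> linf) (mu : linf -> R) : linf -> R := fun x => mu (T x).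

Definition is_eigvec (T : linf -> linf) (mu : linf -> R) : Prop :=
  is_ba mu /\ (exists x, mu x <> 0) /\
  exists lam : R, forall x, adj T mu x = lam * mu x.

(** Delta: finitely additive probability measures on 2^N, as elements of ba(N)
    (mu corresponds to the set function A |-> <1_A, mu>) *)
Definition in_Delta (mu : linf -> R) : Prop :=
  is_ba mu /\
  (forall A, 0 <= mu (lind A)) /\
  mu (lind (fun _ => true)) = 1 /\
  (forall A B : nat -> bool, (forall n, andb (A n) (B n) = false) ->
     mu (lind (fun n => orb (A n) (B n))) = mu (lind A) + mu (lind B)).

Definition setF {K : Type} (T : K -> linf -> linf) (p : linf -> R) : Prop :=
  in_Delta p /\ forall i, is_eigvec (T i) p.

(** weak* closedness of a subset of ba(N): its complement in ba(N) is open for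
    the weak* topology (basic neighbourhoods given by finitely many x's) *)
Definition wstar_closed (D : (linf -> R) -> Prop) : Prop :=
  forall mu, is_ba mu -> ~ D mu ->
    exists (xs : list linf) (eps : R), 0 < eps /\
      forall nu, is_ba nu -> (forall x, In x xs -> Rabs (nu x - mu x) < eps) -> ~ D nu.

Definition is_min_over (D : (linf -> R) -> Prop) (x : linf) (v : R) : Prop :=
  (exists p, D p /\ v = p x) /\ (forall p, D p -> v <= p x).

Section Prefs.
Variable pref : linf -> linf -> Prop.

Definition WeakOrder : Prop :=
  (forall x y, pref x y \/ pref y x) /\
  (forall x y z, pref x y -> pref y z -> pref x z).

Definition Monotonicity : Prop :=
  (forall x y, lge x y -> pref x y) /\
  (pref (lcst 1) (lcst 0) /\ ~ pref (lcst 0) (lcst 1)).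

Definition Continuity : Prop :=
  forall x y z, pref x y -> pref y z ->
    closed_set (fun a => 0 <= a <= 1 /\ pref (lcomb a x z) y) /\
    closed_set (fun a => 0 <= a <= 1 /\ pref y (lcomb a x z)).

Definition ICRP : Prop :=
  forall x y t, pref x y -> pref (ladd x (lcst t)) (ladd y (lcst t)).

Definition Convexity : Prop :=
  forall x y t l, 0 <= l <= 1 -> pref x (lcst t) -> pref y (lcst t) ->
    pref (lcomb l x y) (lcst t).

Definition ISU : Prop :=
  forall x y a, pref x y -> 0 <= a -> pref (lscal a x) (lscal a y).

Definition ITIS (T : linf -> linf) : Prop :=
  forall x d, pref (ladd x d) x -> pref (ladd x (T d)) x.

Definition is_const_equiv (I : linf -> R) : Prop :=
  (forall x, pref x (lcst (I x)) /\ pref (lcst (I x)) x) /\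
  (forall x y, pref x y <-> I y <= I x).

Definition AllConds {K : Type} (T : K -> linf -> linf) : Prop :=
  WeakOrder /\ Monotonicity /\ Continuity /\ ICRP /\ Convexity /\ ISU /\
  (forall i, ITIS (T i)).
End Prefs.

(* Main.v *)
Require Import Defs.
From Stdlib Require Import Reals Lra List Rtopology Classical FunctionalExtensionality ProofIrrelevance.
From mathcomp Require boolp classical_sets.
Open Scope R_scope.
Set Bullet Behavior "Strict Subproofs".

(** Write [I] for the constant equivalent; it is monotone, translation
    invariant, superlinear, and [I (x + d) >= I x] implies [I (x + T_i d) >= I x].
    Consider the functionals [J] with [J 0 = 0] that are monotone, translation
    invariant, concave and share this last property.  They are stable under
    suprema of chains, under [J |-> J (x + .) - J x] and under
    [J |-> J (t .) / t].  If [J] is maximal among those above a given one, then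
    concavity gives [J <= J (t .) / t] for [t] in (0, 1], so [J] is homogeneous,
    hence superadditive, hence [J <= J (x + .) - J x], so [J] is additive.  For
    linear [J] the last property says that [J d >= 0] implies [J (T_i d) >= 0],
    which makes [J] an eigenvector of [T_i^*].  Starting Zorn's lemma from
    [I (x + .) - I x] yields such a [J >= I] with [J x = I x].  Hence [I] is the
    minimum over all eigenvectors in its superdifferential at 0, a weak*-closed
    set because the eigenvalue of [p] is [p (T_i 1)]. *)

(** * Preliminaries: bounded sequences, closed sets of reals, Zorn's lemma *)

Lemma linf_ext (x y : linf) : (forall n, x n = y n) -> x = y.
Proof.
  destruct x as [f Hf], y as [g Hg]; simpl; intro E.
  apply functional_extensionality in E; subst g.
  f_equal; apply proof_irrelevance.
Qed.

Ltac linf_eq := apply linf_ext; intro; simpl; try lra; try (field; lra).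

Lemma linf_bound (x : linf) :
  exists M, 0 <= M /\ lge (lcst M) x /\ lge x (lcst (- M)).
Proof.
  destruct (lbnd x) as [M HM]; exists M; repeat split.
  - apply Rle_trans with (2 := HM O), Rabs_pos.
  - intro n; simpl; generalize (Rle_abs (x n)) (HM n); lra.
  - intro n; simpl; generalize (Rle_abs (- x n)) (HM n); rewrite Rabs_Ropp; lra.
Qed.

Lemma closed_set_adherent (E : R -> Prop) (s : R) :
  closed_set E -> (forall e, 0 < e -> exists a, E a /\ Rabs (a - s) < e) -> E s.
Proof.
  intros HE H; apply NNPP; intro Hs.
  destruct (HE s Hs) as [d Hd].
  destruct (H d (cond_pos d)) as [a [Ha Hd']]; exact (Hd a Hd' Ha).
Qed.

(** Where [f a < v], the Lipschitz bound keeps [f] below [v] within distance [(v - f a) / C].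
    Applied to [I] and to [- I] along a segment, this gives both halves of Continuity. *)
Lemma closed_unit_superlevel (f : R -> R) C v : 0 < C ->
  (forall a b, f a <= f b + C * Rabs (a - b)) ->
  closed_set (fun a => 0 <= a <= 1 /\ v <= f a).
Proof.
  intros HC Hf a Ha; unfold complementary in Ha.
  assert (Hnear : exists d : posreal, forall b, Rabs (b - a) < d ->
            ~ (0 <= b <= 1 /\ v <= f b)).
  { destruct (Rlt_dec a 0) as [H0 | H0];
      [|destruct (Rlt_dec 1 a) as [H1 | H1];
        [|destruct (Rlt_dec (f a) v) as [Hv | Hv]]].
    - assert (H : 0 < - a) by lra; exists (mkposreal _ H); intros b Hb; simpl in Hb.
      generalize (Rle_abs (b - a)); lra.
    - assert (H : 0 < a - 1) by lra; exists (mkposreal _ H); intros b Hb; simpl in Hb.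
      rewrite Rabs_minus_sym in Hb; generalize (Rle_abs (a - b)); lra.
    - assert (H : 0 < (v - f a) / C) by (apply Rdiv_lt_0_compat; lra).
      exists (mkposreal _ H); intros b Hb [_ Hvb]; simpl in Hb.
      apply (Rmult_lt_compat_l C) in Hb; [|lra].
      replace (C * ((v - f a) / C)) with (v - f a) in Hb by (field; lra).
      generalize (Hf b a); lra.
    - exfalso; apply Ha; lra. }
  destruct Hnear as [d Hd]; exists d; intros b Hb; exact (Hd b Hb).
Qed.

(** Transfers the boolean-valued Zorn lemma to [Prop] through [asbool]. The preorder form spares a
    proof of antisymmetry on a subtype. *)
Lemma Zorn_preorder_Prop (T : Type) (t0 : T) (R : T -> T -> Prop) :
  (forall t, R t t) -> (forall r s t, R r s -> R s t -> R r t) ->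
  (forall A : T -> Prop, (forall s t, A s -> A t -> R s t \/ R t s) ->
     exists t, forall s, A s -> R s t) ->
  exists t, forall s, R t s -> R s t.
Proof.
  intros Hr Ht Hc.
  destruct (@classical_sets.ZL_preorder T t0 (fun s t => boolp.asbool (R s t)))
    as [t Hmax].
  - intro t; apply boolp.asboolT, Hr.
  - intros r s t H1 H2; apply boolp.asboolT.
    exact (Ht _ _ _ (boolp.asboolW H1) (boolp.asboolW H2)).
  - intros A HA; destruct (Hc A) as [t H].
    + intros s t Hs Ht'; destruct (HA s t Hs Ht'); [left | right];
        apply boolp.asboolW; assumption.
    + exists t; intros s Hs; apply boolp.asboolT; auto.
  - exists t; intros s Hs; apply boolp.asboolW, Hmax, boolp.asboolT, Hs.
Qed.

(** * Invariant concave niveloids and their stability properties *)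

Section Invariant.
Context {K : Type} (T : K -> linf -> linf).
Hypothesis T_linear : forall i, is_linear_map (T i).

Lemma map_add i x y : T i (ladd x y) = ladd (T i x) (T i y).
Proof. apply linf_ext; intro n; apply (T_linear i). Qed.

Lemma map_scal i a x : T i (lscal a x) = lscal a (T i x).
Proof. apply linf_ext; intro n; apply (T_linear i). Qed.

Lemma map_cst i t : T i (lcst t) = lscal t (T i (lcst 1)).
Proof. rewrite <- map_scal; f_equal; linf_eq. Qed.

(** Niveloids are the monotone, translation invariant functionals. Invariance is required at every
    base point [x], not only at 0, so that it survives the shift [J (x + .) - J x]. *)
Record invariant_niveloid (J : linf -> R) : Prop := {
  niv_zero : J (lcst 0) = 0;
  niv_mono : forall x y, lge x y -> J y <= J x;
  niv_trans : forall x t, J (ladd x (lcst t)) = J x + t;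
  niv_concave : forall l x y, 0 <= l <= 1 ->
    l * J x + (1 - l) * J y <= J (lcomb l x y);
  niv_invariant : forall i x d, J x <= J (ladd x d) -> J x <= J (ladd x (T i d)) }.

Lemma niv_cst J t : invariant_niveloid J -> J (lcst t) = t.
Proof.
  intro H; replace (lcst t) with (ladd (lcst 0) (lcst t)) by linf_eq.
  rewrite (niv_trans _ H), (niv_zero _ H); lra.
Qed.

Lemma niv_shift J x : invariant_niveloid J ->
  invariant_niveloid (fun d => J (ladd x d) - J x).
Proof.
  intro H; split.
  - replace (ladd x (lcst 0)) with x by linf_eq; lra.
  - intros y z Hyz; apply Rplus_le_compat_r, (niv_mono _ H).
    intro n; generalize (Hyz n); simpl; lra.
  - intros y t; replace (ladd x (ladd y (lcst t))) with (ladd (ladd x y) (lcst t))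
      by linf_eq.
    rewrite (niv_trans _ H); lra.
  - intros l y z Hl.
    replace (ladd x (lcomb l y z)) with (lcomb l (ladd x y) (ladd x z)) by linf_eq.
    generalize (niv_concave _ H l (ladd x y) (ladd x z) Hl); lra.
  - intros i y d Hd.
    assert (A : forall e, ladd x (ladd y e) = ladd (ladd x y) e) by (intro; linf_eq).
    rewrite A in Hd |- *.
    generalize (niv_invariant _ H i (ladd x y) d); lra.
Qed.

Lemma niv_rescale J t : 0 < t -> invariant_niveloid J ->
  invariant_niveloid (fun d => J (lscal t d) / t).
Proof.
  intros Ht H.
  assert (Hdiv : forall a b, a <= b -> a / t <= b / t).
  { intros a b Hab; apply Rmult_le_compat_r; [|exact Hab].
    left; apply Rinv_0_lt_compat, Ht. }
  split.
  - replace (lscal t (lcst 0)) with (lcst 0) by linf_eq.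
    rewrite (niv_zero _ H); field; lra.
  - intros y z Hyz; apply Hdiv, (niv_mono _ H); intro n; simpl.
    apply Rmult_le_compat_l; [lra | apply Hyz].
  - intros y s.
    replace (lscal t (ladd y (lcst s))) with (ladd (lscal t y) (lcst (t * s)))
      by linf_eq.
    rewrite (niv_trans _ H); field; lra.
  - intros l y z Hl.
    replace (lscal t (lcomb l y z)) with (lcomb l (lscal t y) (lscal t z))
      by linf_eq.
    generalize (Hdiv _ _ (niv_concave _ H l (lscal t y) (lscal t z) Hl)); lra.
  - intros i y d Hd.
    assert (A : forall e, lscal t (ladd y e) = ladd (lscal t y) (lscal t e))
      by (intro; linf_eq).
    rewrite A in Hd |- *; apply Hdiv; rewrite <- map_scal.
    apply (niv_invariant _ H).
    apply Rmult_le_reg_r with (/ t); [apply Rinv_0_lt_compat, Ht | exact Hd].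
Qed.

(** The chain condition enters through [join]: concavity and invariance involve values at several
    points, and functionals that are nearly optimal at different points are replaced by one member
    above both. *)
Lemma niv_chain_sup (A : (linf -> R) -> Prop) :
  (exists J, A J) -> (forall J, A J -> invariant_niveloid J) ->
  (forall J J', A J -> A J' -> (forall x, J x <= J' x) \/ (forall x, J' x <= J x)) ->
  exists S, invariant_niveloid S /\ forall J, A J -> forall x, J x <= S x.
Proof.
  intros [J0 HJ0] HA Hchain.
  assert (lub : forall x, {m | is_lub (fun v => exists J, A J /\ v = J x) m}).
  { intro x; apply completeness.
    (* The supremum is finite: [x <= M] gives [J x <= J M = M] for every member. *)
    - destruct (linf_bound x) as [M [_ [HM _]]]; exists M; intros v [J [HJ ->]].
      rewrite <- (niv_cst J M) by auto; apply (niv_mono _ (HA J HJ)), HM.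
    - exists (J0 x), J0; auto. }
  set (S := fun x => proj1_sig (lub x)).
  assert (up : forall J, A J -> forall x, J x <= S x).
  { intros J HJ x; apply (proj1 (proj2_sig (lub x))); exists J; auto. }
  assert (least : forall x b, (forall J, A J -> J x <= b) -> S x <= b).
  { intros x b Hb; apply (proj2 (proj2_sig (lub x))); intros v [J [HJ ->]]; auto. }
  assert (approx : forall x e, 0 < e -> exists J, A J /\ S x - e < J x).
  { intros x e He; apply NNPP; intro Hn.
    assert (S x <= S x - e); [|lra].
    apply least; intros J HJ; apply Rnot_lt_le; intro; apply Hn; exists J; auto. }
  assert (join : forall J J', A J -> A J' ->
            exists L, A L /\ forall x, J x <= L x /\ J' x <= L x).
  { intros J J' HJ HJ'; destruct (Hchain J J' HJ HJ').
    - exists J'; split; [auto | intro x; split; [auto | lra]].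
    - exists J; split; [auto | intro x; split; [lra | auto]]. }
  exists S; split; [split | exact up].
  - apply Rle_antisym.
    + apply least; intros J HJ; rewrite (niv_zero _ (HA J HJ)); lra.
    + generalize (up J0 HJ0 (lcst 0)); rewrite (niv_zero _ (HA J0 HJ0)); lra.
  - intros x y Hxy; apply least; intros J HJ.
    apply Rle_trans with (J x); [apply (niv_mono _ (HA J HJ)), Hxy | auto].
  - intros x t; apply Rle_antisym.
    + apply least; intros J HJ; rewrite (niv_trans _ (HA J HJ)).
      generalize (up J HJ x); lra.
    + assert (S x <= S (ladd x (lcst t)) - t); [|lra].
      apply least; intros J HJ; generalize (up J HJ (ladd x (lcst t))).
      rewrite (niv_trans _ (HA J HJ)); lra.
  - intros l x y Hl; apply le_epsilon; intros e He.
    destruct (approx x e He) as [J [HJ Hx]], (approx y e He) as [J' [HJ' Hy]].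
    destruct (join J J' HJ HJ') as [L [HL HJL]].
    generalize (niv_concave _ (HA L HL) l x y Hl) (up L HL (lcomb l x y)).
    assert (l * (S x - e) <= l * L x)
      by (apply Rmult_le_compat_l; generalize (HJL x); lra).
    assert ((1 - l) * (S y - e) <= (1 - l) * L y)
      by (apply Rmult_le_compat_l; generalize (HJL y); lra).
    lra.
  - intros i x d Hd.
    destruct (linf_bound (T i (lcst 1))) as [M [HM0 [HM _]]].
    apply least; intros J HJ; apply le_epsilon; intros e He.
    (* A slack [dl] absorbs the fact that suprema need not be attained; [T_i]
       turns it into at most [dl * M]. *)
    set (dl := e / (M + 1)).
    assert (Hdl : 0 < dl) by (apply Rdiv_lt_0_compat; lra).
    assert (HdM : dl * M <= e).
    { replace e with (dl * (M + 1)) by (unfold dl; field; lra).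
      apply Rmult_le_compat_l; lra. }
    destruct (approx (ladd x d) dl Hdl) as [J' [HJ' Hx]].
    destruct (join J J' HJ HJ') as [L [HL HJL]].
    (* [L x <= S x <= S (x + d) < J' (x + d) + dl <= L (x + d) + dl]. *)
    assert (H1 : L x <= L (ladd x (ladd d (lcst dl)))).
    { replace (ladd x (ladd d (lcst dl))) with (ladd (ladd x d) (lcst dl)) by linf_eq.
      rewrite (niv_trans _ (HA L HL)).
      generalize (up L HL x) (HJL (ladd x d)); lra. }
    apply (niv_invariant _ (HA L HL) i) in H1.
    assert (H2 : L (ladd x (T i (ladd d (lcst dl))))
                 <= L (ladd (ladd x (T i d)) (lcst (dl * M)))).
    { apply (niv_mono _ (HA L HL)); intro n; rewrite map_add, map_cst; simpl.
      generalize (Rmult_le_compat_l dl _ _ (Rlt_le _ _ Hdl) (HM n)); simpl; lra. }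
    rewrite (niv_trans _ (HA L HL)) in H2.
    generalize (HJL x) (up L HL (ladd x (T i d))); lra.
Qed.

(** * Maximal niveloids are linear eigenvectors *)

Lemma niv_maximal J0 : invariant_niveloid J0 ->
  exists J, invariant_niveloid J /\ (forall x, J0 x <= J x) /\
    forall J', invariant_niveloid J' -> (forall x, J x <= J' x) ->
      forall x, J' x = J x.
Proof.
  intro H0.
  set (above := {J | invariant_niveloid J /\ forall x, J0 x <= J x}).
  destruct (Zorn_preorder_Prop above
    (exist _ J0 (conj H0 (fun x => Rle_refl _)))
    (fun J J' => forall x, proj1_sig J x <= proj1_sig J' x)) as [[J [HJ HJ0]] Hmax].
  - intros J x; lra.
  - intros J J' J'' H H' x; apply Rle_trans with (1 := H x), H'.
  - intros A HA.
    (* Adjoining [J0] makes the family nonempty even for an empty chain. It stays a chain, since all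
       its members lie above [J0]. *)
    destruct (niv_chain_sup
      (fun J => J = J0 \/ exists J', A J' /\ J = proj1_sig J')) as [S [HS Hup]].
    + exists J0; auto.
    + intros J [-> | [J' [_ ->]]]; [exact H0 | apply (proj2_sig J')].
    + intros J J' [-> | [L [HL ->]]] [-> | [L' [HL' ->]]].
      * left; intro; lra.
      * left; apply (proj2_sig L').
      * right; apply (proj2_sig L).
      * apply HA; assumption.
    + assert (HJ0 : forall x, J0 x <= S x) by (apply Hup; auto).
      exists (exist _ S (conj HS HJ0)); intros J HJ x; simpl.
      apply Hup; right; exists J; auto.
  - exists J; split; [exact HJ | split; [exact HJ0 |]].
    intros J' HJ' Hle x; apply Rle_antisym; [|auto].
    assert (HJ0' : forall x, J0 x <= J' x)
      by (intro z; apply Rle_trans with (1 := HJ0 z), Hle).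
    exact (Hmax (exist _ J' (conj HJ' HJ0')) Hle x).
Qed.

(** [x <= y + e] gives [J x <= J y + e] by monotonicity and translation. This supplies the norm
    continuity demanded by [is_ba]. *)
Lemma niv_lipschitz J (x y : linf) e : invariant_niveloid J ->
  (forall n, Rabs (x n - y n) <= e) -> Rabs (J x - J y) <= e.
Proof.
  intros H Hxy.
  assert (A : forall u v : linf, (forall n, Rabs (u n - v n) <= e) -> J u <= J v + e).
  { intros u v Huv; rewrite <- (niv_trans _ H); apply (niv_mono _ H); intro n.
    generalize (Huv n) (Rle_abs (u n - v n)); simpl; lra. }
  apply Rabs_le; split.
  - assert (J y <= J x + e); [|lra].
    apply A; intro n; rewrite Rabs_minus_sym; apply Hxy.
  - generalize (A x y Hxy); lra.
Qed.

Lemma niv_maximal_linear J : invariant_niveloid J ->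
  (forall J', invariant_niveloid J' -> (forall x, J x <= J' x) ->
     forall x, J' x = J x) ->
  (forall x y, J (ladd x y) = J x + J y) /\ (forall a x, J (lscal a x) = a * J x).
Proof.
  intros H Hmax.
  (* Writing [t z] as a convex combination of [z] and 0 requires [t <= 1]; there concavity and
     [J 0 = 0] put the rescaled functional above [J]. *)
  assert (hom1 : forall t x, 0 < t <= 1 -> J (lscal t x) = t * J x).
  { intros t x Ht.
    assert (E : J (lscal t x) / t = J x); [|rewrite <- E; field; lra].
    apply (Hmax _ (niv_rescale J t (proj1 Ht) H)); intro z.
    apply Rmult_le_reg_l with t; [lra|].
    replace (t * (J (lscal t z) / t)) with (J (lscal t z)) by (field; lra).
    replace (lscal t z) with (lcomb t z (lcst 0)) by linf_eq.
    assert (Ht' : 0 <= t <= 1) by lra.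
    generalize (niv_concave _ H t z (lcst 0) Ht'); rewrite (niv_zero _ H); lra. }
  assert (add : forall x y, J (ladd x y) = J x + J y).
  { intros x y.
    assert (E : J (ladd x y) - J x = J y); [|lra].
    apply (Hmax _ (niv_shift J x H)); intro z.
    assert (Hh : 0 <= 1 / 2 <= 1) by lra.
    generalize (niv_concave _ H (1 / 2) x z Hh).
    replace (lcomb (1 / 2) x z) with (lscal (1 / 2) (ladd x z)) by linf_eq.
    rewrite hom1 by lra; lra. }
  (* For [t > 1], [hom1] is applied with factor [/ t] to [lscal t x]. *)
  assert (hom : forall t x, 0 < t -> J (lscal t x) = t * J x).
  { intros t x Ht; destruct (Rle_dec t 1) as [H1 | H1]; [auto|].
    assert (E : J (lscal (/ t) (lscal t x)) = / t * J (lscal t x)).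
    { apply hom1; split; [apply Rinv_0_lt_compat, Ht|].
      rewrite <- Rinv_1; apply Rinv_le_contravar; lra. }
    replace (lscal (/ t) (lscal t x)) with x in E by linf_eq.
    rewrite E; field; lra. }
  split; [exact add|].
  intros a x; destruct (Rtotal_order a 0) as [Ha | [-> | Ha]]; [| |auto].
  - assert (E : J (ladd (lscal a x) (lscal (- a) x)) = 0).
    { rewrite <- (niv_zero _ H); f_equal; linf_eq. }
    rewrite add, (hom (- a)) in E by lra; lra.
  - replace (lscal 0 x) with (lcst 0) by linf_eq; rewrite (niv_zero _ H); lra.
Qed.

(** The vector [d = x - J x] satisfies [J d = 0], so invariance at 0 gives
    [0 <= J (T d) = J (T x) - J x * J (T 1)]. The same bound for [- x] is the reverse inequality. *)
Lemma niv_linear_eigen J i : invariant_niveloid J ->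
  (forall x y, J (ladd x y) = J x + J y) -> (forall a x, J (lscal a x) = a * J x) ->
  forall x, J (T i x) = J (T i (lcst 1)) * J x.
Proof.
  intros H add hom.
  assert (A : forall x, J (T i (lcst 1)) * J x <= J (T i x)).
  { intro x.
    assert (B := niv_invariant _ H i (lcst 0) (ladd x (lcst (- J x)))).
    rewrite map_add, map_cst, !add, hom, (niv_zero _ H), (niv_cst _ _ H) in B; lra. }
  intro x; apply Rle_antisym; [|auto].
  generalize (A (lscal (-1) x)); rewrite map_scal, !hom; lra.
Qed.

(** * The eigenvectors dominating [I] *)

(** Naming the eigenvalue [p (T i 1)] instead of quantifying over it turns the eigenvector condition
    into a polynomial equation in three evaluations of [p]. *)
Definition eigen_core (I p : linf -> R) : Prop :=
  is_ba p /\ (forall x, I x <= p x) /\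
  forall i x, p (T i x) = p (T i (lcst 1)) * p x.

(** For a maximal [p] above [I (x + .) - I x], superadditivity gives [I <= p], and the direction
    [- x] gives [- I x <= - p x]. *)
Lemma eigen_core_attained I x : invariant_niveloid I ->
  (forall x y, I x + I y <= I (ladd x y)) ->
  exists p, eigen_core I p /\ p x = I x.
Proof.
  intros H super.
  destruct (niv_maximal _ (niv_shift I x H)) as [p [Hp [Hle Hmax]]].
  destruct (niv_maximal_linear p Hp Hmax) as [add hom].
  assert (HI : forall y, I y <= p y).
  { intro y; generalize (Hle y) (super x y); lra. }
  exists p; split; [split; [|split]|].
  - split; [exact add | split; [exact hom|]].
    intros y e He; exists e; split; [exact He|].
    intros z Hz; exact (niv_lipschitz p y z e Hp Hz).
  - exact HI.
  - intros i y; apply niv_linear_eigen; assumption.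
  - apply Rle_antisym; [|apply HI].
    generalize (Hle (lscal (-1) x)).
    replace (ladd x (lscal (-1) x)) with (lcst 0) by linf_eq.
    rewrite hom, (niv_zero _ H); lra.
Qed.

(** Domination at 1 and at -1 forces [p 1 = 1], which also makes [p] nonzero; domination at
    indicators gives positivity. *)
Lemma eigen_core_setF I p : invariant_niveloid I -> eigen_core I p -> setF T p.
Proof.
  intros H [[add [hom cont]] [HI eig]].
  assert (one : p (lcst 1) = 1).
  { apply Rle_antisym.
    - generalize (HI (lcst (-1))); rewrite (niv_cst _ _ H).
      replace (lcst (-1)) with (lscal (-1) (lcst 1)) by linf_eq.
      rewrite hom; lra.
    - apply Rle_trans with (2 := HI (lcst 1)); rewrite (niv_cst _ _ H); lra. }
  assert (ba : is_ba p) by (repeat split; assumption).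
  split; [split; [exact ba | split; [|split]]|].
  - intro A; apply Rle_trans with (2 := HI _).
    replace 0 with (I (lcst 0)) by apply (niv_zero _ H).
    apply (niv_mono _ H); intro n; simpl.
    destruct (A n); lra.
  - replace (lind (fun _ => true)) with (lcst 1) by linf_eq; exact one.
  - intros A B HAB; rewrite <- add; f_equal; apply linf_ext; intro n; simpl.
    generalize (HAB n); destruct (A n), (B n); simpl; intro; try discriminate; lra.
  - intro i; split; [exact ba | split].
    + exists (lcst 1); lra.
    + exists (p (T i (lcst 1))); apply eig.
Qed.

Lemma eigen_core_closed I : wstar_closed (eigen_core I).
Proof.
  intros mu Hmu Hn.
  destruct (classic (forall x, I x <= mu x)) as [HI | HI].
  - assert (exists i x, mu (T i x) <> mu (T i (lcst 1)) * mu x) as [i [x Hx]].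
    { apply NNPP; intro H; apply Hn; split; [exact Hmu | split; [exact HI|]].
      intros i x; apply NNPP; intro Hx; apply H; exists i, x; exact Hx. }
    set (a := mu (T i x)) in *; set (b := mu (T i (lcst 1))) in *.
    set (c := mu x) in *.
    set (g := Rabs (a - b * c)).
    assert (Hg : 0 < g) by (apply Rabs_pos_lt; lra).
    assert (Hbc : 0 < 2 + Rabs b + Rabs c)
      by (generalize (Rabs_pos b) (Rabs_pos c); lra).
    (* The part [e <= 1] bounds the quadratic error [(b' - b) * (c' - c)] by [e]. All four errors
       then sum to less than [e * (2 + Rabs b + Rabs c) <= g], contradicting [D]. *)
    set (e := Rmin 1 (g / (2 + Rabs b + Rabs c))).
    assert (He : 0 < e) by (apply Rmin_pos; [lra | apply Rdiv_lt_0_compat; lra]).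
    assert (He1 : e <= 1) by apply Rmin_l.
    assert (Heg : e * (2 + Rabs b + Rabs c) <= g).
    { replace g with (g / (2 + Rabs b + Rabs c) * (2 + Rabs b + Rabs c))
        by (field; lra).
      apply Rmult_le_compat_r; [lra | apply Rmin_r]. }
    exists (T i x :: T i (lcst 1) :: x :: nil), e; split; [exact He|].
    intros nu _ Hnu [_ [_ eig]].
    assert (Ha := Hnu (T i x)); assert (Hb := Hnu (T i (lcst 1))).
    assert (Hc := Hnu x); simpl in Ha, Hb, Hc.
    specialize (Ha ltac:(auto)); specialize (Hb ltac:(auto)).
    specialize (Hc ltac:(auto)).
    rewrite (eig i x) in Ha; fold a in Ha; fold b in Hb; fold c in Hc.
    set (b' := nu (T i (lcst 1))) in *; set (c' := nu x) in *.
    assert (D : g <= Rabs (b' * c' - a) + Rabs ((b' - b) * (c' - c))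
                     + Rabs ((b' - b) * c) + Rabs (b * (c' - c))).
    { unfold g.
      replace (a - b * c) with
        (- (b' * c' - a) + (b' - b) * (c' - c) + (b' - b) * c + b * (c' - c)) by ring.
      eapply Rle_trans; [apply Rabs_triang|]; apply Rplus_le_compat_r.
      eapply Rle_trans; [apply Rabs_triang|]; apply Rplus_le_compat_r.
      eapply Rle_trans; [apply Rabs_triang|]; apply Rplus_le_compat_r.
      rewrite Rabs_Ropp; lra. }
    rewrite !Rabs_mult in D.
    assert (Rabs (b' - b) * Rabs (c' - c) <= e * 1)
      by (apply Rmult_le_compat; try apply Rabs_pos; lra).
    assert (Rabs (b' - b) * Rabs c <= e * Rabs c)
      by (apply Rmult_le_compat_r; [apply Rabs_pos | lra]).
    assert (Rabs b * Rabs (c' - c) <= Rabs b * e)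
      by (apply Rmult_le_compat_l; [apply Rabs_pos | lra]).
    lra.
  - apply not_all_ex_not in HI as [x Hx]; apply Rnot_le_lt in Hx.
    exists (x :: nil), (I x - mu x); split; [lra|].
    intros nu _ Hnu [_ [HI _]].
    assert (Hd := Hnu x (or_introl eq_refl)).
    generalize (HI x) (Rle_abs (nu x - mu x)); lra.
Qed.

(** * From the axioms to a superlinear constant equivalent *)

Section ConstantEquivalent.
Variable pref : linf -> linf -> Prop.
Hypothesis conds : AllConds pref T.

(** If [s < t] and [s] were weakly preferred to [t], subtracting [s] and scaling by [/ (t - s)]
    would make 0 weakly preferred to 1. *)
Lemma pref_cst s t : pref (lcst s) (lcst t) <-> t <= s.
Proof.
  destruct conds as [[total _] [[mono strict] [_ [icrp [_ [isu _]]]]]].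
  split; [|intro; apply mono; intro n; assumption].
  intro H; apply Rnot_lt_le; intro Hst.
  apply (icrp _ _ (- s)) in H.
  apply (fun h => isu _ _ (/ (t - s)) h) in H;
    [|left; apply Rinv_0_lt_compat; lra].
  apply strict.
  replace (lcst 0) with (lscal (/ (t - s)) (ladd (lcst s) (lcst (- s)))) by linf_eq.
  replace (lcst 1) with (lscal (/ (t - s)) (ladd (lcst t) (lcst (- s)))) by linf_eq.
  exact H.
Qed.

(** Continuity is used on the segment from [s - 1] to [s]: all weights below 1 belong to a closed
    set, hence so does 1. *)
Lemma pref_ge_limit x s : (forall t, t < s -> pref x (lcst t)) -> pref x (lcst s).
Proof.
  destruct conds as [[total _] [_ [cont _]]]; intro H.
  destruct (total x (lcst s)) as [Hx | Hx]; [exact Hx|].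
  destruct (cont (lcst s) x (lcst (s - 1)) Hx) as [_ Hcl]; [apply H; lra|].
  assert (E : forall a, lcomb a (lcst s) (lcst (s - 1)) = lcst (s - 1 + a))
    by (intro a; linf_eq).
  apply (closed_set_adherent _ 1) in Hcl.
  - destruct Hcl as [_ Hcl]; rewrite E in Hcl.
    replace s with (s - 1 + 1) by ring; exact Hcl.
  - intros e He; exists (1 - Rmin 1 (e / 2)).
    assert (0 < Rmin 1 (e / 2)) by (apply Rmin_pos; lra).
    assert (Rmin 1 (e / 2) <= 1) by apply Rmin_l.
    assert (Rmin 1 (e / 2) <= e / 2) by apply Rmin_r.
    split; [split; [lra|]; rewrite E; apply H; lra | apply Rabs_def1; lra].
Qed.

Lemma pref_le_limit x s : (forall t, s < t -> pref (lcst t) x) -> pref (lcst s) x.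
Proof.
  destruct conds as [[total _] [_ [cont _]]]; intro H.
  destruct (total x (lcst s)) as [Hx | Hx]; [|exact Hx].
  destruct (cont (lcst (s + 1)) x (lcst s)) as [Hcl _]; [apply H; lra | exact Hx|].
  assert (E : forall a, lcomb a (lcst (s + 1)) (lcst s) = lcst (s + a))
    by (intro a; linf_eq).
  apply (closed_set_adherent _ 0) in Hcl.
  - destruct Hcl as [_ Hcl]; rewrite E in Hcl.
    replace s with (s + 0) by ring; exact Hcl.
  - intros e He; exists (Rmin 1 (e / 2)).
    assert (0 < Rmin 1 (e / 2)) by (apply Rmin_pos; lra).
    assert (Rmin 1 (e / 2) <= 1) by apply Rmin_l.
    assert (Rmin 1 (e / 2) <= e / 2) by apply Rmin_r.
    split; [split; [lra|]; rewrite E; apply H; lra | apply Rabs_def1; lra].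
Qed.

(** The constant equivalent of [x] is the supremum of the constants to which [x] is weakly
    preferred; the two limit lemmas give indifference there. *)
Lemma const_equiv_exists : exists I, is_const_equiv pref I.
Proof.
  destruct conds as [[total trans] [[mono _] _]].
  assert (lub : forall x, {s | is_lub (fun t => pref x (lcst t)) s}).
  { intro x; apply completeness; destruct (linf_bound x) as [M [_ [HM HM']]].
    - exists M; intros t Ht; apply pref_cst, (trans _ x); auto.
    - exists (- M); auto. }
  assert (eqv : forall x,
    pref x (lcst (proj1_sig (lub x))) /\ pref (lcst (proj1_sig (lub x))) x).
  { intro x; destruct (lub x) as [s [Hup Hleast]]; simpl; split.
    - apply pref_ge_limit; intros t Ht.
      destruct (total x (lcst t)) as [|Hx]; [assumption|].
      assert (s <= t); [|lra].
      apply Hleast; intros r Hr; apply pref_cst, (trans _ x); assumption.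
    - apply pref_le_limit; intros t Ht.
      destruct (total x (lcst t)) as [Hx|]; [|assumption].
      generalize (Hup t Hx); lra. }
  exists (fun x => proj1_sig (lub x)); split; [exact eqv|].
  intros x y; destruct (eqv x), (eqv y); split; intro H'.
  - apply pref_cst, (trans _ x); [assumption|].
    apply (trans _ y); assumption.
  - apply pref_cst in H'.
    apply (trans _ _ _ H), (trans _ _ _ H'); assumption.
Qed.

Lemma const_equiv_of_pref I x t : is_const_equiv pref I ->
  pref x (lcst t) -> pref (lcst t) x -> I x = t.
Proof.
  destruct conds as [[_ trans] _]; intros [HI _] H1 H2; destruct (HI x).
  apply Rle_antisym; apply pref_cst, (trans _ x); assumption.
Qed.

Lemma const_equiv_niveloid I : is_const_equiv pref I ->
  invariant_niveloid I /\ forall x y, I x + I y <= I (ladd x y).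
Proof.
  intro HI; assert (eqv := fun x t => const_equiv_of_pref I x t HI).
  destruct conds as [_ [[mono _] [_ [icrp [conv [isu inv]]]]]].
  destruct HI as [HI rep].
  assert (cst : forall t, I (lcst t) = t)
    by (intro t; apply eqv; apply pref_cst; lra).
  assert (tr : forall x t, I (ladd x (lcst t)) = I x + t).
  { intros x t.
    apply eqv; replace (lcst (I x + t)) with (ladd (lcst (I x)) (lcst t)) by linf_eq;
      apply icrp, HI. }
  assert (conc : forall l x y, 0 <= l <= 1 ->
            l * I x + (1 - l) * I y <= I (lcomb l x y)).
  { intros l x y Hl.
    (* Convexity compares with a single constant, so [x] and [y] are first translated to the common
       level 0. *)
    assert (Z : forall z, pref (ladd z (lcst (- I z))) (lcst 0)).
    { intro z; apply rep; rewrite tr, cst; lra. }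
    assert (C := conv _ _ 0 l Hl (Z x) (Z y)); apply rep in C; rewrite cst in C.
    replace (lcomb l (ladd x (lcst (- I x))) (ladd y (lcst (- I y))))
      with (ladd (lcomb l x y) (lcst (- (l * I x + (1 - l) * I y)))) in C by linf_eq.
    rewrite tr in C; lra. }
  split; [split|].
  - apply cst.
  - intros x y Hxy; apply rep, mono, Hxy.
  - exact tr.
  - exact conc.
  - intros i x d Hd; apply rep, (inv i), rep, Hd.
  - intros x y.
    (* ISU with factor 2 turns concavity at the midpoint into superadditivity. *)
    assert (half : forall z, I (lscal 2 z) = 2 * I z).
    { intro z; apply eqv;
        replace (lcst (2 * I z)) with (lscal 2 (lcst (I z))) by linf_eq;
        apply isu; try lra; apply HI. }
    assert (Hh : 0 <= 1 / 2 <= 1) by lra.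
    generalize (conc (1 / 2) x y Hh) (half (lcomb (1 / 2) x y)).
    replace (lscal 2 (lcomb (1 / 2) x y)) with (ladd x y) by linf_eq; lra.
Qed.

Lemma representation : exists D : (linf -> R) -> Prop,
  (exists p, D p) /\ wstar_closed D /\ (forall p, D p -> setF T p) /\
  exists I : linf -> R,
    (forall x, is_min_over D x (I x)) /\
    is_const_equiv pref I /\
    (forall J, is_const_equiv pref J -> forall x, J x = I x).
Proof.
  destruct const_equiv_exists as [I HI].
  destruct (const_equiv_niveloid I HI) as [niv super].
  assert (att := fun x => eigen_core_attained I x niv super).
  exists (eigen_core I); split; [|split; [|split]].
  - destruct (att (lcst 0)) as [p [Hp _]]; exists p; exact Hp.
  - apply eigen_core_closed.
  - intros p; apply eigen_core_setF, niv.
  - exists I; split; [|split; [exact HI|]].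
    + intro x; split.
      * destruct (att x) as [p [Hp E]]; exists p; auto.
      * intros p [_ [Hp _]]; apply Hp.
    + intros J HJ x.
      destruct HI as [HI _]; apply const_equiv_of_pref; [exact HJ | apply HI ..].
Qed.
End ConstantEquivalent.
End Invariant.

(** * Positivity and normalisation of finitely additive probabilities *)

(* A sequence [x] with values in [0, 1] is [(1_A + y) / 2] with
   [A = {x >= 1/2}] and [y] again with values in [0, 1], so a lower bound [- C]
   for [p] on such sequences improves to [- C / 2]. *)
Lemma in_Delta_positive p x : in_Delta p -> lge x (lcst 0) -> 0 <= p x.
Proof.
  intros [[add [hom cont]] [ind _]] Hx.
  assert (zero : p (lcst 0) = 0).
  { replace (lcst 0) with (lscal 0 (lcst 0)) by linf_eq; rewrite hom; ring. }
  (* Continuity at 0 with tolerance 1 yields the initial lower bound [- / dl] on sequences with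
     values in [0, 1]. *)
  destruct (cont (lcst 0) 1) as [dl [Hdl Hcont]]; [lra|].
  assert (Hpow : forall k (z : linf), (forall n, 0 <= z n <= 1) ->
            - (/ dl * (1 / 2) ^ k) <= p z).
  { induction k as [|k IH]; intros z Hz; simpl pow.
    - assert (B : Rabs (p (lcst 0) - p (lscal dl z)) <= 1).
      { apply Hcont; intro n; simpl.
        assert (0 <= dl * z n <= dl * 1)
          by (split; [apply Rmult_le_pos | apply Rmult_le_compat_l];
              generalize (Hz n); lra).
        apply Rabs_le; lra. }
      rewrite zero, hom in B.
      generalize (Rle_abs (0 - dl * p z)); intro B'.
      apply Rmult_le_reg_l with dl; [lra|].
      replace (dl * - (/ dl * 1)) with (-1) by (field; lra); lra.
    - set (A := fun n => if Rle_dec (1 / 2) (z n) then true else false).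
      set (y := ladd (lscal 2 z) (lscal (-1) (lind A))).
      replace z with (lscal (1 / 2) (ladd (lind A) y)) by (unfold y; linf_eq).
      rewrite hom, add.
      assert (Hy := IH y); assert (HA := ind A).
      assert (forall n, 0 <= y n <= 1).
      { intro n; simpl; unfold A; generalize (Hz n).
        destruct (Rle_dec (1 / 2) (z n)); lra. }
      specialize (Hy H); lra. }
  assert (unit : forall z : linf, (forall n, 0 <= z n <= 1) -> 0 <= p z).
  { intros z Hz; apply le_epsilon; intros e He.
    destruct (pow_lt_1_zero (1 / 2)) with (y := e * dl) as [N HN].
    - rewrite Rabs_right; lra.
    - apply Rmult_lt_0_compat; lra.
    - generalize (HN N (le_n N)) (Hpow N z Hz); intros H1 H2.
      assert (H3 := Rle_abs ((1 / 2) ^ N)).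
      assert (/ dl * (1 / 2) ^ N <= e); [|lra].
      replace e with (/ dl * (e * dl)) by (field; lra).
      apply Rmult_le_compat_l; [left; apply Rinv_0_lt_compat | ]; lra. }
  destruct (linf_bound x) as [M [HM [HxM _]]].
  (* Scaling by [M + 1] brings [x] into [0, 1] and avoids dividing by 0 when [M = 0]. *)
  replace x with (lscal (M + 1) (lscal (/ (M + 1)) x)) by linf_eq.
  rewrite hom; apply Rmult_le_pos; [lra|]; apply unit; intro n; simpl.
  assert (0 < / (M + 1)) by (apply Rinv_0_lt_compat; lra).
  generalize (Hx n) (HxM n); simpl; intros H1 H2; split.
  - apply Rmult_le_pos; lra.
  - replace 1 with (/ (M + 1) * (M + 1)) at 2 by (field; lra).
    apply Rmult_le_compat_l; lra.
Qed.

Lemma in_Delta_mono p x y : in_Delta p -> lge x y -> p y <= p x.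
Proof.
  intros Hp Hxy; assert (Hba := Hp); destruct Hba as [[add [hom _]] _].
  assert (0 <= p (ladd x (lscal (-1) y))).
  { apply in_Delta_positive; [exact Hp|]; intro n; generalize (Hxy n); simpl; lra. }
  rewrite add, hom in H; lra.
Qed.

Lemma in_Delta_cst p t : in_Delta p -> p (lcst t) = t.
Proof.
  intros [[_ [hom _]] [_ [one _]]].
  replace (lcst t) with (lscal t (lind (fun _ => true))) by linf_eq.
  rewrite hom, one; ring.
Qed.

(** * Axioms satisfied by minima over sets of probabilities *)

Section MinFunctional.
Variables (D : (linf -> R) -> Prop) (I : linf -> R).
Hypothesis D_Delta : forall p, D p -> in_Delta p.
Hypothesis I_min : forall x, is_min_over D x (I x).

Lemma min_ge x v : (forall p, D p -> v <= p x) -> v <= I x.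
Proof. destruct (I_min x) as [[p [Hp ->]] _]; auto. Qed.

Lemma min_le p x : D p -> I x <= p x.
Proof. apply I_min. Qed.

Lemma min_cst t : I (lcst t) = t.
Proof. destruct (I_min (lcst t)) as [[p [Hp ->]] _]; apply in_Delta_cst; auto. Qed.

Lemma min_mono x y : lge x y -> I y <= I x.
Proof.
  intro H; apply min_ge; intros p Hp.
  apply Rle_trans with (p y); [apply min_le, Hp | apply in_Delta_mono; auto].
Qed.

Lemma min_trans x t : I (ladd x (lcst t)) = I x + t.
Proof.
  apply Rle_antisym.
  - assert (I (ladd x (lcst t)) - t <= I x); [|lra].
    apply min_ge; intros p Hp; generalize (min_le p (ladd x (lcst t)) Hp).
    rewrite (proj1 (proj1 (D_Delta p Hp))), in_Delta_cst by auto; lra.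
  - apply min_ge; intros p Hp; generalize (min_le p x Hp).
    rewrite (proj1 (proj1 (D_Delta p Hp))), in_Delta_cst by auto; lra.
Qed.

Lemma min_concave l x y : 0 <= l <= 1 -> l * I x + (1 - l) * I y <= I (lcomb l x y).
Proof.
  intro Hl; apply min_ge; intros p Hp; destruct (D_Delta p Hp) as [[add [hom _]] _].
  unfold lcomb; rewrite add, !hom; apply Rplus_le_compat;
    (apply Rmult_le_compat_l; [lra | apply min_le, Hp]).
Qed.

Lemma min_scal a x : 0 <= a -> I (lscal a x) = a * I x.
Proof.
  intro Ha; apply Rle_antisym.
  - destruct (I_min x) as [[p [Hp ->]] _].
    destruct (D_Delta p Hp) as [[_ [hom _]] _]; rewrite <- hom; apply min_le, Hp.
  - apply min_ge; intros p Hp; destruct (D_Delta p Hp) as [[_ [hom _]] _].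
    rewrite hom; apply Rmult_le_compat_l; [exact Ha | apply min_le, Hp].
Qed.

(** Two points of the line through [x] and [z] differ by [(a - b) * (x - z)], which is at most
    [(M + N) * Rabs (a - b)]; the extra 1 keeps [C] positive. *)
Lemma min_segment_lipschitz x z : exists C, 0 < C /\ forall a b,
  I (lcomb a x z) <= I (lcomb b x z) + C * Rabs (a - b).
Proof.
  destruct (linf_bound x) as [M [HM0 [HM HM']]].
  destruct (linf_bound z) as [N [HN0 [HN HN']]].
  exists (M + N + 1); split; [lra|]; intros a b.
  rewrite <- min_trans; apply min_mono; intro n; simpl.
  generalize (HM n) (HM' n) (HN n) (HN' n); simpl; intros.
  assert ((a - b) * (x n - z n) <= (M + N + 1) * Rabs (a - b)); [|lra].
  eapply Rle_trans; [apply Rle_abs|]; rewrite Rabs_mult, Rmult_comm.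
  apply Rmult_le_compat_r; [apply Rabs_pos | apply Rabs_le; lra].
Qed.

Lemma min_continuity : Continuity (fun x y => I y <= I x).
Proof.
  intros x y z _ _; destruct (min_segment_lipschitz x z) as [C [HC Hlip]]; split.
  - exact (closed_unit_superlevel (fun a => I (lcomb a x z)) C (I y) HC Hlip).
  - assert (H : closed_set (fun a => 0 <= a <= 1 /\ - I y <= - I (lcomb a x z))).
    { apply closed_unit_superlevel with C; [exact HC|]; intros a b.
      generalize (Hlip b a); rewrite Rabs_minus_sym; lra. }
    intros a Ha; destruct (H a) as [d Hd].
    + intros [Ha1 Ha2]; apply Ha; split; lra.
    + exists d; intros b Hb [Hb1 Hb2]; apply (Hd b Hb); split; lra.
Qed.

(* With [lam] the eigenvalue of [p],
   [p (x + T d) = (1 - lam) p x + lam p (x + d)] is a convex combination. *)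
Lemma min_invariant (T : linf -> linf) : is_positive_map T ->
  (forall p, D p -> is_eigvec T p /\ adj T p (lcst 1) <= 1) ->
  ITIS (fun x y => I y <= I x) T.
Proof.
  intros Tpos HD x d Hd; apply min_ge; intros p Hp.
  destruct (HD p Hp) as [[_ [_ [lam Hlam]]] Hle].
  assert (HDp := D_Delta p Hp); assert (add := proj1 (proj1 HDp)).
  (* Since [p 1 = 1], the eigenvalue is [lam = p (T 1)]; positivity of [T] and the bound [Hle] place
     it in [0, 1]. *)
  assert (Hlam0 : 0 <= adj T p (lcst 1)).
  { apply (in_Delta_positive p); [exact HDp|]; apply Tpos; intro n; simpl; lra. }
  rewrite Hlam, in_Delta_cst in Hle, Hlam0 by auto.
  rewrite add; change (p (T d)) with (adj T p d); rewrite Hlam.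
  (* Both [p x] and [p (x + d)] are at least [I x], the second through [Hd]. *)
  assert (A := min_le p x Hp); assert (B := min_le p (ladd x d) Hp).
  rewrite add in B.
  assert ((1 - lam) * I x <= (1 - lam) * p x) by (apply Rmult_le_compat_l; lra).
  assert (lam * I x <= lam * (p x + p d)) by (apply Rmult_le_compat_l; lra).
  lra.
Qed.
End MinFunctional.

Theorem theorem3 (K : Type) (T : K -> linf -> linf)
  (HT : forall i, is_linear_map (T i) /\ is_positive_map (T i) /\ is_continuous_map (T i)) :
  (forall pref : linf -> linf -> Prop,
     AllConds pref T ->
     exists D : (linf -> R) -> Prop,
       (exists p, D p) /\ wstar_closed D /\ (forall p, D p -> setF T p) /\
       exists I : linf -> R,
         (forall x, is_min_over D x (I x)) /\
         is_const_equiv pref I /\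
         (forall J, is_const_equiv pref J -> forall x, J x = I x))
  /\
  (forall (D : (linf -> R) -> Prop) (I : linf -> R),
     (exists p, D p) -> wstar_closed D -> (forall p, D p -> setF T p) ->
     (forall x, is_min_over D x (I x)) ->
     (forall i p, setF T p -> adj (T i) p (lcst 1) <= 1) ->
     AllConds (fun x y => I y <= I x) T).
Proof.
  split.
  - intros pref; apply representation; apply HT.
  - intros D I _ _ HF Hmin Hlam.
    assert (HD : forall p, D p -> in_Delta p) by (intros p Hp; apply HF, Hp).
    assert (cst := min_cst D I HD Hmin).
    split; [|split; [|split; [|split; [|split; [|split]]]]].
    + split; [intros x y; lra | intros x y z; lra].
    + split; [exact (min_mono D I HD Hmin)|]; rewrite !cst; lra.
    + exact (min_continuity D I HD Hmin).
    + intros x y t H; rewrite !(min_trans D I HD Hmin); lra.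
    + intros x y t l Hl; rewrite cst; intros Hx Hy.
      apply Rle_trans with (2 := min_concave D I HD Hmin l x y Hl).
      assert (l * t <= l * I x) by (apply Rmult_le_compat_l; lra).
      assert ((1 - l) * t <= (1 - l) * I y) by (apply Rmult_le_compat_l; lra).
      lra.
    + intros x y a H Ha; rewrite !(min_scal D I HD Hmin) by assumption.
      apply Rmult_le_compat_l; assumption.
    + intro i; apply (min_invariant D I HD Hmin (T i)); [apply HT|].
      intros p Hp; split; [apply HF, Hp | apply Hlam, HF, Hp].
Qed.
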